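(* For every graph $G$ on $n\geq 1$ vertices with treewidth $t$, $pdim(G) \leq (t+2)(\log_2 n + 1)$.
   Context: For a graph $G=(V,E)$ and $l\in\mathbb{N}$, an $l$-encoding of $G$ is an injective function $\phi: V\to\mathbb{N}^l$ such that for all $u,v\in V$, $\{u,v\}\in E$ if and only if $\phi(u)$ and $\phi(v)$ differ in all $l$ coordinates. The product dimension $pdim(G)$ is the minimum $l$ such that an $l$-encoding of $G$ exists. A tree decomposition of $G$ is a pair $(\{X_i : i\in I\}, T)$ where $T$ is a tree with node set $I$ and each $X_i\subseteq V(G)$, such that every vertex lies in some $X_i$, every edge has both endpoints in some $X_i$, and $X_i\cap X_k\subseteq X_j$ whenever $j$ lies on the $T$-path from $i$ to $k$; its width is $\max_i |X_i|-1$, and the treewidth of $G$ is the minimum width over all tree decompositions. *)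

(* Defs.v *)
From Stdlib Require Import Reals.
From mathcomp Require Import all_boot.
Set Implicit Arguments. Unset Strict Implicit. Unset Printing Implicit Defensive.

Definition simple_graph (V : finType) (E : rel V) : Prop :=
  symmetric E /\ irreflexive E.

Definition encoding (V : finType) (E : rel V) (l : nat)
  (phi : V -> {ffun 'I_l -> nat}) : Prop :=
  injective phi /\
  forall u v : V, E u v <-> (forall c : 'I_l, phi u c <> phi v c).

Definition has_encoding (V : finType) (E : rel V) (l : nat) : Prop :=
  exists phi : V -> {ffun 'I_l -> nat}, encoding E phi.

Definition spath (I : finType) (T : rel I) (i k : I) (p : seq I) : Prop :=
  path T i p /\ last i p = k /\ uniq (i :: p).

Definition is_tree (I : finType) (T : rel I) : Prop :=
  [/\ 0 < #|I|, symmetric T, irreflexive T,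
      (forall i k : I, exists p, spath T i k p) &
      (forall i k : I, forall p q, spath T i k p -> spath T i k q -> p = q)].

Definition tree_decomposition (V : finType) (E : rel V)
  (I : finType) (T : rel I) (X : I -> {set V}) : Prop :=
  [/\ is_tree T,
      (forall v : V, exists i, v \in X i),
      (forall u v : V, E u v -> exists i, (u \in X i) && (v \in X i)) &
      (forall i j k : I, forall p, spath T i k p -> j \in i :: p ->
           X i :&: X k \subset X j)].

Definition width (V I : finType) (X : I -> {set V}) : nat :=
  (\max_(i : I) #|X i|) - 1.

Definition is_treewidth (V : finType) (E : rel V) (t : nat) : Prop :=
  (exists (I : finType) (T : rel I) (X : I -> {set V}),
      tree_decomposition E T X /\ width X = t) /\
  (forall (I : finType) (T : rel I) (X : I -> {set V}),
      tree_decomposition E T X -> t <= width X).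

(* Main.v *)
Require Import Defs.
From Stdlib Require Import Reals Lra.
From mathcomp Require Import all_boot zify.
Set Implicit Arguments. Unset Strict Implicit. Unset Printing Implicit Defensive.

(* An encoding is a family of proper colourings such that any two non-adjacent
   vertices agree in one of them and any two distinct vertices differ in one.
   Make the tree decomposition smooth: all bags have t+1 vertices and neighbouring
   bags differ by one exchange, so there are n-t-1 exchanges, and keeping the
   exchanged vertices in the same slot gives chi : V -> {0..t}, injective on bags.
   Let N be the odd element of {t+1, t+2}.
   - N colourings, indexed by i mod N, pair the class a with the class i - a; they
     deal with the non-adjacent pairs having the same chi or a common bag.
   - For the other pairs, a suitable bag S splits a piece with m exchanges into
     three pieces containing S with at most ceil(m/2) exchanges each. Giving S private
     colours and piece k the colour chi + k i mod N, for i <> 0 mod N, makes all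
     pairs across the pieces agree, as the differences of the k's are +-1, +-2 and N
     is odd; pairs inside a piece are treated recursively. A piece with two
     exchanges needs a single colouring, and one with fewer exchanges none.
   - One colouring is injective.
   The colourings of the pieces glue, since they are injective on the common bag S. *)

(** * Smooth rooted tree decompositions *)

Section SmoothTree.
Variables (V : finType) (t : nat).
Notation bag := {ffun 'I_t.+1 -> V}.

(* A rooted tree decomposition in which every bag has [t.+1] vertices, indexed by
   slots: [Step a y s] moves to the bag where [y] replaces the vertex in slot [a]. *)
Inductive stree := Leaf | Step of 'I_t.+1 & V & stree | Join of stree & stree.

Definition upd (b : bag) a y : bag := [ffun c => if c == a then y else b c].

Fixpoint bags (b : bag) (s : stree) : seq bag :=
  match s with
  | Leaf => [:: b]
  | Step a y s' => b :: bags (upd b a y) s'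
  | Join s1 s2 => bags b s1 ++ bags b s2
  end.

Fixpoint news (s : stree) : seq V :=
  match s with
  | Leaf => [::]
  | Step _ y s' => y :: news s'
  | Join s1 s2 => news s1 ++ news s2
  end.

Definition verts (b : bag) s := codom b ++ news s.
(** Each exchange brings in a vertex absent from the root bag and from all other exchanges, so a
    vertex once replaced never returns below; the bags containing it form a subtree. *)
Definition valid b s := uniq (verts b s).

Lemma size_verts b s : size (verts b s) = t.+1 + size (news s).
Proof. by rewrite size_cat size_codom card_ord. Qed.

Lemma mem_upd (b : bag) a y x :
  x \in codom (upd b a y) -> x = y \/ x \in codom b.
Proof.
case/codomP=> c ->; rewrite ffunE; case: ifP => _; first by left.
by right; apply: codom_f.
Qed.

Lemma mem_upd_new (b : bag) a y : y \in codom (upd b a y).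
Proof. by apply/codomP; exists a; rewrite ffunE eqxx. Qed.

Lemma mem_upd_old (b : bag) a y c : c != a -> b c \in codom (upd b a y).
Proof. by move=> ca; apply/codomP; exists c; rewrite ffunE (negbTE ca). Qed.

Lemma upd_inj (b : bag) a y :
  injective b -> y \notin codom b -> injective (upd b a y).
Proof.
move=> bi yb c d; rewrite !ffunE.
case: (eqVneq c a) => [->|ca]; case: (eqVneq d a) => [->|da] // e.
- by case/negP: yb; rewrite e codom_f.
- by case/negP: yb; rewrite -e codom_f.
- exact: bi.
Qed.

Lemma validP (b : bag) s :
  reflect [/\ injective b, uniq (news s) & {in news s, forall x, x \notin codom b}]
    (valid b s).
Proof.
rewrite /valid /verts cat_uniq; apply: (iffP and3P) => [[u1 /hasPn u2 u3]|[u1 u2 u3]].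
  by split=> //; apply/injectiveP.
by split=> //; [apply/injectiveP | apply/hasPn].
Qed.

Lemma valid_step b a y s :
  valid b (Step a y s) -> y \notin codom b /\ valid (upd b a y) s.
Proof.
case/validP=> bi /= /andP[ys us] nb; have yb : y \notin codom b.
  by apply: nb; rewrite inE eqxx.
split=> //; apply/validP; split=> //; first exact: upd_inj.
move=> x xs; apply/negP => /mem_upd[xy|]; first by rewrite -xy xs in ys.
by apply/negP/nb; rewrite inE xs orbT.
Qed.

Lemma valid_join b s1 s2 :
  valid b (Join s1 s2) ->
  [/\ valid b s1, valid b s2 & {in news s1, forall x, x \notin news s2}].
Proof.
case/validP=> bi /=; rewrite cat_uniq => /and3P[u1 /hasPn h u2] nb.
split; try (apply/validP; split=> // x xs; apply: nb; rewrite mem_cat xs ?orbT //).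
by move=> x x1; apply/negP => /h/negP; apply.
Qed.

Lemma mem_root b s : b \in bags b s.
Proof. by elim: s b => [|a y s IH|s1 IH1 s2 IH2] b /=; rewrite ?inE ?eqxx // mem_cat IH1. Qed.

Lemma bags_verts b s (g : bag) x : g \in bags b s -> x \in codom g -> x \in verts b s.
Proof.
elim: s b => [|a y s IH|s1 IH1 s2 IH2] b /=.
- by rewrite inE => /eqP-> xg; rewrite mem_cat xg.
- rewrite inE => /predU1P[->|/IH h] xg; first by rewrite mem_cat xg.
  move: (h xg); rewrite /verts !mem_cat /= inE => /orP[/mem_upd[->|->]|->] //.
    by rewrite eqxx orbT.
  by rewrite !orbT.
- rewrite mem_cat => /orP[/IH1|/IH2] h /h; rewrite /verts !mem_cat => /orP[]-> //;
    by rewrite !orbT.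
Qed.

Lemma verts_bags b s x : x \in verts b s -> exists2 g : bag, g \in bags b s & x \in codom g.
Proof.
elim: s b => [|a y s IH|s1 IH1 s2 IH2] b /=; rewrite /verts mem_cat /=.
- by rewrite orbF => xb; exists b; rewrite ?inE.
- case/orP=> [xb|]; first by exists b; rewrite // inE eqxx.
  rewrite inE => h.
  have /IH[g gs xg] : x \in verts (upd b a y) s.
    rewrite mem_cat; case/predU1P: h => [->|->]; first by rewrite mem_upd_new.
    by rewrite orbT.
  by exists g; rewrite // inE gs orbT.
- rewrite mem_cat => /orP[xb|/orP[xs|xs]].
  + by exists b; rewrite // mem_cat mem_root.
  + have /IH1[g gs xg] : x \in verts b s1 by rewrite mem_cat xs orbT.
    by exists g; rewrite // mem_cat gs.
  + have /IH2[g gs xg] : x \in verts b s2 by rewrite mem_cat xs orbT.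
    by exists g; rewrite // mem_cat gs orbT.
Qed.

Lemma bag_inj b s (g : bag) : valid b s -> g \in bags b s -> injective g.
Proof.
elim: s b => [|a y s IH|s1 IH1 s2 IH2] b /=.
- by case/validP=> bi _ _; rewrite inE => /eqP->.
- move=> v; rewrite inE => /predU1P[->|]; first by case/validP: v.
  by case: (valid_step v) => _ /IH; apply.
- by case/valid_join=> v1 v2 _; rewrite mem_cat => /orP[/(IH1 _ v1)|/(IH2 _ v2)].
Qed.

(** Greedy extension along the tree: the value at the vertex [y] of a step is free to choose, as no
    bag treated before contains [y]. The first hypothesis says that [Q] only looks at the values on
    the bag. *)
Lemma extend_bags (C : Type) (Q : bag -> (V -> C) -> Prop) :
  (forall (g : bag) c c', (forall a, c (g a) = c' (g a)) -> Q g c -> Q g c') ->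
  (forall (g : bag) c a y, y \notin codom g -> Q g c ->
     exists x, Q (upd g a y) (fun v => if v == y then x else c v)) ->
  forall s b c, valid b s -> Q b c ->
  exists c', (forall v, v \notin news s -> c' v = c v) /\
    (forall g, g \in bags b s -> Q g c').
Proof.
move=> Qext Qstep; elim=> [|a y s IH|s1 IH1 s2 IH2] b c vb Qb /=.
- by exists c; split=> // g; rewrite inE => /eqP->.
- case: (valid_step vb) => yb vs; have [x Qx] := Qstep _ _ a _ yb Qb.
  have [c' [cE Qc]] := IH _ _ vs Qx; exists c'; split=> [v|g].
    by rewrite inE negb_or => /andP[vy /cE->]; rewrite (negbTE vy).
  rewrite inE => /predU1P[->|/Qc//]; apply: Qext Qb => d.
  have [_ _ nb] := validP _ _ vb.
  have ny : b d \notin y :: news s by apply/negP => /nb; rewrite codom_f.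
  move: ny; rewrite inE negb_or => /andP[dy ds]; rewrite cE // (negbTE dy) //.
- case: (valid_join vb) => v1 v2 dis; have [c1 [c1E Q1]] := IH1 _ _ v1 Qb.
  have nb (g : bag) x : g \in bags b s1 -> x \in codom g -> x \notin news s2.
    move=> /bags_verts h /h; rewrite mem_cat => /orP[xb|/dis//].
    by apply/negP; have [_ _ nb] := validP _ _ v2; move=> /nb; rewrite xb.
  have [c2 [c2E Q2]] : exists c', (forall v, v \notin news s2 -> c' v = c1 v) /\
      (forall g, g \in bags b s2 -> Q g c').
    by apply: IH2 v2 _; apply: Q1 (mem_root _ _).
  exists c2; split=> [v|g].
    by rewrite mem_cat negb_or => /andP[n1 n2]; rewrite c2E ?c1E.
  rewrite mem_cat => /orP[gs|/Q2//]; apply: Qext (Q1 _ gs) => a.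
  by rewrite c2E // (nb g) ?codom_f.
Qed.

(** Greedy extension: the replacing vertex inherits the slot of the replaced one. *)
Lemma slot_function b s : valid b s ->
  exists chi : V -> 'I_t.+1, forall g : bag, g \in bags b s -> forall a, chi (g a) = a.
Proof.
move=> vb; have bi : injective b by case/validP: vb.
pose c0 v := odflt ord0 [pick a | b a == v].
have [|||c' [_ h]] := @extend_bags 'I_t.+1 (fun (g : bag) c => forall a, c (g a) = a) _ _ s b c0 vb.
- by move=> g c c' e h a; rewrite -e.
- move=> g c a y yg h; exists a => d; rewrite ffunE; case: (eqVneq d a) => [->|da].
    by rewrite eqxx.
  by case: eqP => [e|_ //]; case/negP: yg; rewrite -e codom_f.
- by move=> a; rewrite /c0; case: pickP => [d /eqP/bi //|/(_ a)]; rewrite eqxx.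
by exists c'.
Qed.

(** The exchange becomes a new branch hanging at an occurrence of [g], so no old bag is lost. *)
Lemma insert_step b s g a y : g \in bags b s ->
  exists s', [/\ perm_eq (news s') (y :: news s),
    {subset bags b s <= bags b s'} & upd g a y \in bags b s'].
Proof.
elim: s b => [|d z s IH|s1 IH1 s2 IH2] b /=.
- rewrite inE => /eqP->; exists (Step a y Leaf); split=> //= [x|].
    by rewrite !inE => ->.
  by rewrite !inE eqxx orbT.
- rewrite inE => /predU1P[->|/IH[s' [p sub us]]].
    exists (Join (Step d z s) (Step a y Leaf)); split=> /=.
    + by rewrite -cat_cons perm_catC.
    + by move=> x; rewrite !inE mem_cat => /orP[->|->]; rewrite ?orbT.
    + by rewrite !(inE, mem_cat) eqxx !orbT.
  exists (Step d z s'); split=> /=.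
  + by rewrite (perm_trans (y := z :: y :: news s)) ?perm_cons //;
      apply/permP => f /=; rewrite addnCA.
  + by move=> x; rewrite !inE => /predU1P[->|/sub->]; rewrite ?eqxx ?orbT.
  + by rewrite inE us orbT.
- rewrite mem_cat => /orP[/IH1|/IH2] [s' [p sub us]].
    exists (Join s' s2); split=> /=.
    + by rewrite -cat_cons perm_cat2r.
    + by move=> x; rewrite !mem_cat => /orP[/sub->|->]; rewrite ?orbT.
    + by rewrite mem_cat us.
  exists (Join s1 s'); split=> /=.
  + by rewrite (perm_trans (y := news s1 ++ y :: news s2)) ?perm_cat2l //;
      apply/permP => f; rewrite /= !count_cat /= addnCA.
  + by move=> x; rewrite !mem_cat => /orP[->|/sub->]; rewrite ?orbT.
  + by rewrite mem_cat us orbT.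
Qed.

(** The vertices of [X] missing from [g] enter one by one along a new branch, each replacing a
    vertex outside [X]. The last hypothesis makes them new to the tree; the induction is on their
    number. *)
Lemma insert_set b s (g : bag) (X : {set V}) :
  valid b s -> g \in bags b s -> #|X| <= t.+1 ->
  (forall x, x \in X -> x \in verts b s -> x \in codom g) ->
  exists s', [/\ valid b s', verts b s' =i [predU verts b s & X],
    {subset bags b s <= bags b s'} &
    exists2 g' : bag, g' \in bags b s' & {subset X <= codom g'}].
Proof.
move: {2}#|_| (leqnn #|X :\: [set x in codom g]|) => n.
elim: n s g => [|n IH] s g le vb gs Xt Xg.
  move: le; rewrite leqn0 cards_eq0 setD_eq0 => /subsetP sub.
  have {}sub : {subset X <= codom g} by move=> x /sub; rewrite inE.
  exists s; split=> //; last by exists g.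
  move=> x; rewrite !inE; case xX: (x \in X); rewrite ?orbF ?orbT //.
  by apply: bags_verts gs _; apply: sub.
have gi := bag_inj vb gs.
case: (boolP [exists y, y \in X :\: [set x in codom g]]); last first.
  move/existsPn=> h; apply: (IH s g) => //.
  suff -> : X :\: [set x in codom g] = set0 by rewrite cards0.
  by apply/setP => x; rewrite [RHS]inE; apply: negbTE.
case/existsP=> y; rewrite !inE => /andP[yg yX].
(* If every slot of [g] held a vertex of [X], then with [y] the set [X] would have [t+2]
   elements. *)
have [a aX] : exists a, g a \notin X.
  apply/existsP; rewrite -negb_forall; apply/negP => /forallP h.
  have : #|y |: [set g a | a in 'I_t.+1]| <= #|X|.
    apply: subset_leq_card; apply/subsetP => x; rewrite !inE.
    by case/predU1P=> [->//|/imsetP[a _ ->]].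
  rewrite cardsU1 card_imset // card_ord.
  have -> : y \notin [set g a | a in 'I_t.+1].
    by apply/negP => /imsetP[a _ e]; rewrite e codom_f in yg.
  by move=> /leq_trans/(_ Xt); rewrite add1n ltnn.
have yv : y \notin verts b s by apply/negP => /(Xg _ yX); apply/negP.
have [s' [p sub us]] := insert_step a y gs.
have pv : perm_eq (verts b s') (y :: verts b s).
  rewrite /verts (perm_trans (y := codom b ++ y :: news s)) ?perm_cat2l //.
  by apply/permP => f; rewrite /= !count_cat /= addnCA.
have vb' : valid b s' by rewrite /valid (perm_uniq pv) /= yv.
have Xold x : x \in X -> x \in codom g -> x \in codom (upd g a y).
  move=> xX /codomP[d e]; rewrite e mem_upd_old //.
  by apply: contraNneq aX => <-; rewrite -e.
have [||s2 [v2 e2 sub2 G]] := IH s' _ _ vb' us Xt.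
- rewrite -ltnS (leq_trans _ le) //; apply: proper_card; apply/properP; split.
    apply/subsetP => x; rewrite !inE => /andP[nx xX]; rewrite xX andbT.
    by apply: contra nx; apply: Xold.
  by exists y; rewrite !inE ?yg ?yX // mem_upd_new.
- move=> x xX; rewrite (perm_mem pv) inE => /predU1P[->|/(Xg _ xX)].
    exact: mem_upd_new.
  exact: Xold.
exists s2; split=> //.
  move=> x; rewrite e2 !inE (perm_mem pv) inE.
  by case: (eqVneq x y) => [->|//]; rewrite yX !orbT.
by move=> x /sub/sub2.
Qed.

(* [s0] is the part of [s] outside the subtree hanging at [g]. *)
Lemma split_at b s m : 0 < m <= size (news s) ->
  exists g s0 s1 s2,
  [/\ perm_eq (news s) (news s0 ++ news s1 ++ news s2),
      size (news s1) <= m, size (news s2) <= m &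
      m <= size (news s1) + size (news s2)] /\
  [/\ g \in bags b s0 &
      bags b s =i bags b s0 ++ bags g s1 ++ bags g s2].
Proof.
elim: s b => [|a y s IH|s1 IH1 s2 IH2] b /= /andP[m0 ms].
- by move: m0; rewrite ltnNge ms.
- case: (leqP m (size (news s))) => h.
    have [|g [s0 [s1 [s2 [[p l1 l2 l3] [gs be]]]]]] := IH (upd b a y).
      by rewrite m0.
    exists g, (Step a y s0), s1, s2; split; split=> //=.
    + by rewrite perm_cons.
    + by rewrite inE gs orbT.
    + by move=> x; rewrite !inE be.
  (* Here [news s] has exactly [m - 1] vertices, so the subtree starting with this step has exactly
     [m] exchanges. *)
  exists b, Leaf, (Step a y s), Leaf; split; split=> //=.
  + by rewrite cats0.
  + by rewrite addn0.
  + by rewrite inE.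
  + by move=> x; rewrite !(inE, mem_cat) /=; do ?case: eqP; rewrite ?orbT ?orbF.
- rewrite size_cat in ms.
  case: (leqP m (size (news s1))) => h1.
    have [|g [r0 [r1 [r2 [[p l1 l2 l3] [gs be]]]]]] := IH1 b.
      by rewrite m0.
    exists g, (Join r0 s2), r1, r2; split; split=> //=.
    + apply: (perm_trans (y := (news r0 ++ news r1 ++ news r2) ++ news s2)).
        by rewrite perm_cat2r.
      by rewrite -!catA perm_cat2l catA perm_catC.
    + by rewrite mem_cat gs.
    + by move=> x; rewrite !mem_cat be !mem_cat; do !case: (x \in _).
  case: (leqP m (size (news s2))) => h2.
    have [|g [r0 [r1 [r2 [[p l1 l2 l3] [gs be]]]]]] := IH2 b.
      by rewrite m0.
    exists g, (Join s1 r0), r1, r2; split; split=> //=.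
    + by rewrite -catA perm_cat2l.
    + by rewrite mem_cat gs orbT.
    + by move=> x; rewrite !mem_cat be !mem_cat; do !case: (x \in _).
  (* Each branch has fewer than [m] exchanges, but together they have at least [m]: the descent
     stops at this join. *)
  exists b, Leaf, s1, s2; split; split=> //=; try exact: ltnW.
  + by rewrite inE.
  + move=> x; rewrite !(inE, mem_cat); case: eqP => //= ->.
    by rewrite mem_root.
Qed.
End SmoothTree.

(** * From an arbitrary tree decomposition to a smooth one *)

Lemma crossing_edge (I : finType) (T : rel I) (J : {set I}) x p :
  path T x p -> x \in J -> last x p \notin J ->
  exists j k, [/\ j \in J, k \notin J & T j k].
Proof.
elim: p x => [|y p IH] x /=; first by move=> _ ->.
case/andP=> xy py xJ ly; case: (boolP (y \in J)) => yJ; first exact: IH py yJ ly.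
by exists x, y.
Qed.

Section FromDecomposition.
Variables (V I : finType) (t : nat) (T : rel I) (X : I -> {set V}).
Notation bag := {ffun 'I_t.+1 -> V}.
Hypotheses (Tsym : symmetric T)
  (Tconn : forall i k, exists p, spath T i k p)
  (Tint : forall i j k p, spath T i k p -> j \in i :: p -> X i :&: X k \subset X j).

Let inside (J : {set I}) : rel I := [rel i j | [&& T i j, i \in J & j \in J]].

(** A simple path inside [J] from [j] to [i], prolonged by [k] outside [J], is a simple path of the
    tree through [j], so the intersection property applies. *)
Lemma interface_bag (J : {set I}) j k i x : connect (inside J) j i -> j \in J ->
  k \notin J -> T j k -> x \in X k -> x \in X i -> x \in X j.
Proof.
case/connectP=> p0 pp0 -> jJ kJ jk; case/shortenP: pp0 => p pp up _ xk xi.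
have pJ : {subset j :: p <= J}.
  elim: p {up xi} j pp jJ {jk} => [|y p IH] j /=; first by move=> _ jJ z; rewrite inE => /eqP->.
  by case/andP=> /and3P[_ _ yJ] py jJ z; rewrite inE => /predU1P[->//|]; apply: IH.
have/(Tint (j := j)) sub : spath T k (last j p) (j :: p).
  split; [|split=> //]; last by rewrite cons_uniq up andbT; apply: contra kJ => /pJ.
  rewrite /= Tsym jk; apply: sub_path pp => u v /=; by case/and3P.
by apply: (subsetP (sub _)); rewrite !inE ?eqxx ?orbT ?xk.
Qed.

(** From the full bag at [r], a connected set [J] of treated nodes grows node by node. A node [k]
    next to [j] in [J] shares with the treated bags only vertices of [X j], so [insert_set] can
    attach [X k] at a bag containing [X j]. *)
Lemma stree_of_decomposition r :
  (forall i, #|X i| <= t.+1) -> #|X r| = t.+1 ->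
  exists (b : bag) s, [/\ valid b s,
    verts b s =i [pred v | [exists i, v \in X i]] &
    forall i, exists2 g : bag, g \in bags b s & {subset X i <= codom g}].
Proof.
move=> Xt Xr.
suff grow n : n < #|I| -> exists (J : {set I}) (b : bag) s,
    [/\ #|J| = n.+1, r \in J & {in J, forall i, connect (inside J) r i}] /\
    [/\ valid b s, verts b s =i [pred v | [exists i in J, v \in X i]] &
      {in J, forall i, exists2 g : bag, g \in bags b s & {subset X i <= codom g}}].
  have I0 : 0 < #|I| by apply/card_gt0P; exists r.
  have [|J [b [s [[cJ _ _] [vb vE h]]]]] := grow #|I|.-1; first by rewrite prednK.
  have JT i : i \in J.
    have /eqP-> : J == setT by rewrite eqEcard subsetT cardsT cJ prednK /=.
    by rewrite inE.
  exists b, s; split=> // [v|i]; last exact: h.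
  by rewrite vE !inE; apply: eq_existsb => i; rewrite JT.
elim: n => [|n IH] nI.
  pose b : bag := [ffun a => enum_val (cast_ord (esym Xr) a)].
  have bi : injective b by move=> a c; rewrite !ffunE => /enum_val_inj/cast_ord_inj.
  have bE v : (v \in codom b) = (v \in X r).
    apply/codomP/idP=> [[a ->]|vr]; first by rewrite ffunE enum_valP.
    exists (cast_ord Xr (enum_rank_in vr v)).
    by rewrite ffunE cast_ordK enum_rankK_in.
  exists [set r], b, (Leaf _ _); split; split.
  - by rewrite cards1.
  - by rewrite inE.
  - by move=> i; rewrite inE => /eqP->.
  - by apply/validP; split.
  - move=> v; rewrite mem_cat orbF bE !inE; apply/idP/existsP => [vr|[i]].
      by exists r; rewrite inE eqxx.
    by rewrite inE => /andP[/eqP->].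
  - by move=> i; rewrite inE => /eqP->; exists b; rewrite ?inE // => v; rewrite bE.
have [J [b [s [[cJ rJ conn] [vb vE h]]]]] := IH (ltnW nI).
have [k0 k0J] : exists k, k \notin J.
  apply/existsP; rewrite -negb_forall; apply/negP => /forallP a.
  have : #|I| <= #|J| by rewrite -cardsT subset_leq_card //; apply/subsetP => i _.
  by rewrite cJ leqNgt nI.
have [p [pp [lp _]]] := Tconn r k0.
have [|j [k [jJ kJ jk]]] := crossing_edge pp rJ; first by rewrite lp.
have [g gs Xg] := h _ jJ.
have cs : connect_sym (inside J).
  by apply: sym_connect_sym => u v; rewrite /inside /= [T u v]Tsym [(u \in J) && _]andbC.
have [|s' [vb' vE' sub [g' g's Xg']]] := insert_set vb gs (Xt k).
  move=> x xk; rewrite vE inE => /existsP[i /andP[iJ xi]]; apply: Xg.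
  apply: (interface_bag (i := i) _ jJ kJ jk xk xi).
  by apply: connect_trans (conn _ iJ); rewrite cs; apply: conn.
have mono : subrel (connect (inside J)) (connect (inside (k |: J))).
  apply: connect_sub => u v /and3P[uv uJ vJ]; apply: connect1.
  by rewrite /inside /= uv !inE uJ vJ !orbT.
exists (k |: J), b, s'; split; split=> //.
- by rewrite cardsU1 kJ cJ.
- by rewrite !inE rJ orbT.
- move=> i; rewrite !inE => /predU1P[->|iJ]; last exact/mono/conn.
  apply: connect_trans (mono _ _ (conn _ jJ)) (connect1 _).
  by rewrite /inside /= jk !inE jJ eqxx orbT.
- move=> v; rewrite vE' !inE vE inE; apply/orP/existsP.
    case=> [/existsP[i /andP[iJ vi]]|vk]; first by exists i; rewrite !inE iJ vi orbT.
    by exists k; rewrite !inE eqxx.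
  case=> i; rewrite !inE => /andP[/predU1P[->|iJ] vi]; first by right.
  by left; apply/existsP; exists i; rewrite iJ.
- move=> i; rewrite !inE => /predU1P[->|/h[d ds Xd]]; first by exists g'.
  by exists d => //; apply: sub.
Qed.
End FromDecomposition.

(** * Splitting a smooth tree into three pieces *)

Section Pieces.
Variables (V : finType) (t : nat).
Notation bag := {ffun 'I_t.+1 -> V}.
Notation piece := (bag * stree V t)%type.
Notation pbags p := (bags p.1 p.2).
Notation pverts p := (verts p.1 p.2).

(** Pieces are indexed by numbers because the index later serves as the multiplier of the colour
    shift. *)
Definition splits (q : piece) (g : bag) (p : 'I_3 -> piece) : Prop :=
  [/\ forall k, valid (p k).1 (p k).2,
      forall k, g \in pbags (p k),
      forall k, {subset pbags (p k) <= pbags q},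
      forall d, d \in pbags q -> exists k, d \in pbags (p k) &
      forall k l x, k != l -> x \in pverts (p k) -> x \in pverts (p l) ->
        x \in codom g].

(** The two subtrees hanging at [g] have at most [m] exchanges each and together at least [m], which
    leaves at most [size (news s) - m] for the outer piece. *)
Lemma exists_split b s m : valid b s -> 0 < m <= size (news s) ->
  exists g p, splits (b, s) g p /\
    forall k, size (news (p k).2) <= maxn m (size (news s) - m).
Proof.
move=> vb hm; have [g [s0 [s1 [s2 [[pe l1 l2 l3] [gs be]]]]]] := split_at b hm.
pose p k : piece := nth (b, s0) [:: (b, s0); (g, s1); (g, s2)] k.
have bi := bag_inj vb.
have [_ un nb] := validP _ _ vb.
have gi : injective g by apply: bi; rewrite be mem_cat gs.
have mem x : (x \in news s) = [|| x \in news s0, x \in news s1 | x \in news s2].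
  by rewrite (perm_mem pe) !mem_cat.
move: un; rewrite (perm_uniq pe) !cat_uniq has_cat negb_or.
case/and3P=> u0 /andP[/hasPn d01 /hasPn d02] /and3P[u1 /hasPn d12 u2].
have b0 x : x \in news s0 -> x \notin codom b by move=> h; apply: nb; rewrite mem h.
have bn x : x \in news s -> x \notin codom b by apply: nb.
have v0 : valid b s0 by apply/validP; split=> //; case/validP: vb.
have gv x : x \in codom g -> (x \in codom b) || (x \in news s0).
  by move=> /(bags_verts gs); rewrite mem_cat.
have g1 x : x \in news s1 -> x \notin codom g.
  move=> x1; apply/negP => /gv/orP[xb|]; last by apply/negP/d01.
  by have := bn x; rewrite mem x1 orbT xb => /(_ isT).
have g2 x : x \in news s2 -> x \notin codom g.
  move=> x2; apply/negP => /gv/orP[xb|]; last by apply/negP/d02.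
  by have := bn x; rewrite mem x2 !orbT xb => /(_ isT).
have v1 : valid g s1 by apply/validP; split.
have v2 : valid g s2 by apply/validP; split.
have e3 (k : 'I_3) : [\/ p k = (b, s0), p k = (g, s1) | p k = (g, s2)].
  by case: k => -[|[|[|//]]] i; rewrite /p /=; [constructor 1|constructor 2|constructor 3].
have sep (k l : 'I_3) x : k < l -> x \in pverts (p k) -> x \in pverts (p l) ->
    x \in codom g.
  have n01 y : y \in verts b s0 -> y \in news s1 -> False.
    rewrite mem_cat => /orP[yb|y0] y1; last by case/negP: (d01 _ y1).
    by have := bn y; rewrite mem y1 orbT yb => /(_ isT).
  have n02 y : y \in verts b s0 -> y \in news s2 -> False.
    rewrite mem_cat => /orP[yb|y0] y1; last by case/negP: (d02 _ y1).
    by have := bn y; rewrite mem y1 !orbT yb => /(_ isT).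
  case: k => -[|[|[|//]]] ik; case: l => -[|[|[|//]]] il //= _; rewrite /p /=.
  - by move=> h; rewrite mem_cat => /orP[//|/(n01 _ h)].
  - by move=> h; rewrite mem_cat => /orP[//|/(n02 _ h)].
  - rewrite !mem_cat => /orP[//|x1] /orP[//|x2].
    by case/negP: (d12 _ x2).
exists g, p; split; last first.
  have sz : size (news s) = size (news s0) + (size (news s1) + size (news s2)).
    by rewrite (perm_size pe) !size_cat.
  by move=> k; case: (e3 k) => ->; rewrite leq_max /= ?l1 ?l2 // sz; move: l3; lia.
split.
- by move=> k; case: (e3 k) => ->.
- by move=> k; case: (e3 k) => -> //=; rewrite mem_root.
- by move=> k x; case: (e3 k) => -> /=; rewrite be !mem_cat => ->; rewrite ?orbT.
- move=> d /=; rewrite be !mem_cat; case/or3P => h.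
  + by exists (@Ordinal 3 0 isT).
  + by exists (@Ordinal 3 1 isT).
  + by exists (@Ordinal 3 2 isT).
- move=> k l x; rewrite neq_ltn => /orP[kl h1 h2|lk h1 h2]; exact: sep h1 h2 || exact: sep h2 h1.
Qed.
End Pieces.

(** * Colourings for pairs in different slots without a common bag *)

(** The equation says that [l - k] times [i] is [a - b] modulo [N]. By symmetry [l - k] is 1 or 2,
    both invertible modulo an odd number, and [i] is nonzero since [a] and [b] differ. *)
Lemma cross_shift N a b k l : odd N -> a < N -> b < N -> a != b ->
  k < 3 -> l < 3 -> k != l ->
  exists2 i, 0 < i < N & (a + k * i) %% N = (b + l * i) %% N.
Proof.
move=> oN; wlog kl : a b k l / k < l => [H|] aN bN ab k3 l3 nkl.
  move: (nkl); rewrite neq_ltn => /orP[/H|lk]; first exact.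
  have ba : b != a by rewrite eq_sym.
  have nlk : l != k by rewrite eq_sym.
  by have [i hi e] := H b a l k lk bN aN ba l3 k3 nlk; exists i.
(* The residue of [a - b] modulo [N]. *)
pose e := if b < a then a - b else a + N - b.
have he : 0 < e < N by rewrite /e; case: ifP; lia.
have eE : b + e = a \/ b + e = a + N by rewrite /e; case: ifP; lia.
suff [i [hi [c ci]]] : exists i, 0 < i < N /\ exists c, b + (l - k) * i = c * N + a.
  exists i => //; have -> : b + l * i = c * N + (a + k * i) by rewrite addnA -ci; nia.
  by rewrite modnMDl.
have [->|->] : l - k = 1 \/ l - k = 2 by lia.
  exists e; split=> //; rewrite mul1n.
  by case: eE => ->; [exists 0 | exists 1]; lia.
(* Half of [e] modulo [N]: if [e] is odd, then [e + N] is even. *)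
exists (if odd e then (e + N)./2 else e./2).
have := odd_double_half e; have := odd_double_half (e + N); rewrite oddD oN.
case: (odd e) => /= h1 h2; (split; first lia).
  by case: eE => h; [exists 1 | exists 2]; lia.
by case: eE => h; [exists 0 | exists 1]; lia.
Qed.

Section Colorings.
Variables (V : finType) (t : nat).
Notation bag := {ffun 'I_t.+1 -> V}.
Notation piece := (bag * stree V t)%type.
Notation pbags p := (bags p.1 p.2).
Notation pverts p := (verts p.1 p.2).

(** When every edge lies in a bag, such a colouring is proper, whatever the edges inside the bags
    are. *)
Definition rainbow (B : seq bag) (c : V -> nat) : Prop :=
  forall d, d \in B -> injective (c \o d).

Definition slotted (B : seq bag) (chi : V -> 'I_t.+1) : Prop :=
  forall d, d \in B -> forall a, chi (d a) = a.

Section Split.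
Variables (q : piece) (g : bag) (p : 'I_3 -> piece).
Hypothesis Hs : splits q g p.

(** Determined by the split only for vertices of the pieces outside [g], where the pieces are
    disjoint; [ord0] is the default outside all pieces. *)
Definition part (x : V) : 'I_3 := odflt ord0 [pick k | x \in pverts (p k)].

Lemma partE k x : x \in pverts (p k) -> x \notin codom g -> part x = k.
Proof.
have [_ _ _ _ sep] := Hs; move=> xk xg; rewrite /part.
case: pickP => [l xl|/(_ k)]; last by rewrite xk.
by apply/eqP; apply: contraNT xg => lk; apply: sep lk xl xk.
Qed.

Lemma split_cover x : x \in pverts q -> exists k, x \in pverts (p k).
Proof.
have [_ _ _ cov _] := Hs.
by case/verts_bags=> d /cov[k dk] xd; exists k; apply: bags_verts dk xd.
Qed.

(** A colour of piece [k] that occurs on [g] is renamed to the slot where it occurs, and any other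
    colour is tagged with [k]. The renamings agree on [g] because each [ck k] is injective there. *)
Lemma glue (ck : 'I_3 -> V -> nat) : (forall k, rainbow (pbags (p k)) (ck k)) ->
  exists c, rainbow (pbags q) c /\
    forall k u v, u \in pverts (p k) -> v \in pverts (p k) -> ck k u = ck k v -> c u = c v.
Proof.
have [_ gp _ cov _] := Hs; move=> rb.
have gi k a a' : ck k (g a) = ck k (g a') -> a = a' by apply: (rb k g (gp k)).
pose G k v : 'I_t.+1 + 'I_3 * nat :=
  if [pick a | ck k (g a) == ck k v] is Some a then inl a else inr (k, ck k v).
have Gg k a : G k (g a) = inl a.
  by rewrite /G; case: pickP => [a' /eqP/gi->//|/(_ a)]; rewrite eqxx.
have GP k x : x \in pverts (p k) -> G (part x) x = G k x.
  move=> xk; case: (boolP (x \in codom g)) => [/codomP[a ->]|xg]; first by rewrite !Gg.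
  by rewrite (partE xk xg).
have Ginj k u v : G k u = G k v -> ck k u = ck k v.
  rewrite /G; case: pickP => [a /eqP<-|_]; case: pickP => [a' /eqP<-|_] //.
    by case=> ->.
  by case.
exists (fun v => pickle (G (part v) v)); split.
  move=> d /cov[k dk] a a' /= /(pcan_inj pickleK).
  have dv e : d e \in pverts (p k) by apply: bags_verts dk _; apply: codom_f.
  by rewrite !(GP k) // => /Ginj; apply: (rb k d dk).
by move=> k u v uk vk e; rewrite !(GP k) // /G e.
Qed.

Variable chi : V -> 'I_t.+1.
Hypothesis Hchi : slotted (pbags q) chi.

(* Piece [k] of the split uses the colours [chi v + k * i] modulo [N], so that two
   vertices of different pieces agree for one [i] ([cross_shift]). *)
Lemma shift_rainbow N i : t < N ->
  rainbow (pbags q) (fun v => if v \in codom g then pickle (inl v : V + nat)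
                              else pickle (inr ((chi v + part v * i) %% N) : V + nat)).
Proof.
have [vp _ sub cov _] := Hs; move=> tN d dq a a' /=; have [k dk] := cov d dq.
have dv e : d e \in pverts (p k) by apply: bags_verts dk _; apply: codom_f.
case: ifPn => h; case: ifPn => h' /(pcan_inj pickleK) // [].
  by apply: (bag_inj (vp k) dk).
rewrite !(partE (dv _)) // !(Hchi dq) => /eqP; rewrite eqn_modDr.
by rewrite !modn_small => [/eqP/val_inj||]; rewrite ?(leq_trans (ltn_ord _)).
Qed.

(** A piece with at most one exchange has at most [t+2] vertices, hence at most one outside [g], so
    the colour 0 occurs at most once in a bag. *)
Lemma single_rainbow : (forall k, size (news (p k).2) <= 1) ->
  rainbow (pbags q) (fun v => if v \in codom g then (pickle v).+1 else 0).
Proof.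
have [vp gp sub cov _] := Hs; move=> sz d dq a a' /=; have [k dk] := cov d dq.
have dv e : d e \in pverts (p k) by apply: bags_verts dk _; apply: codom_f.
have di := bag_inj (vp k) dk.
case: ifPn => h; case: ifPn => h' //; first by case=> /(pcan_inj pickleK)/di.
move=> _; apply/eqP; case: eqP => // /eqP ne; exfalso.
have : size [:: d a, d a' & codom g] <= size (pverts (p k)).
  apply: uniq_leq_size => [|x].
    rewrite /= inE negb_or h h' (inj_eq di) ne /=.
    by apply/injectiveP; apply: bag_inj (vp k) (gp k).
  by rewrite !inE => /or3P[/eqP->|/eqP->|/(bags_verts (gp k))].
by rewrite size_verts /= size_codom card_ord; have := sz k; lia.
Qed.

End Split.

(** With one exchange, only the new vertex and the one it replaces have no common bag, and these two
    have the same slot. *)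
Lemma common_bag_small b s chi u v : slotted (bags b s) chi ->
  size (news s) <= 1 -> u \in verts b s -> v \in verts b s -> chi u != chi v ->
  exists d : bag, [/\ d \in bags b s, u \in codom d & v \in codom d].
Proof.
have nil_bag r x : size (news r) = 0 -> x \in verts b r -> x \in codom b.
  by move/size0nil=> e; rewrite /verts e cats0.
elim: s => [|a y s _|s1 IH1 s2 IH2] Hc /=.
- by rewrite /verts cats0 => _ ub vb _; exists b; rewrite inE.
- rewrite /verts /= => sz; have -> : news s = [::] by apply: size0nil; lia.
  have ya : chi y = a.
    by have := Hc (upd b a y) _ a; rewrite ffunE eqxx; apply; rewrite inE mem_root orbT.
  have bc c : chi (b c) = c by apply: Hc; rewrite mem_root.
  have yb x : x \in codom b -> chi y != chi x -> x \in codom (upd b a y).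
    by case/codomP=> c ->; rewrite ya bc eq_sym; apply: mem_upd_old.
  have um : upd b a y \in b :: bags (upd b a y) s by rewrite inE mem_root orbT.
  rewrite !mem_cat !inE => /orP[ub|/eqP->] /orP[vb|/eqP->] uv.
  + by exists b; rewrite inE eqxx.
  + by exists (upd b a y); rewrite um mem_upd_new yb // eq_sym.
  + by exists (upd b a y); rewrite um mem_upd_new yb.
  + by rewrite eqxx in uv.
- rewrite size_cat => sz.
  have c1 : slotted (bags b s1) chi by move=> d h; apply: Hc; rewrite mem_cat h.
  have c2 : slotted (bags b s2) chi by move=> d h; apply: Hc; rewrite mem_cat h orbT.
  have ver x : x \in verts b (Join s1 s2) = (x \in verts b s1) || (x \in verts b s2).
    by rewrite /verts /= !mem_cat; do !case: (x \in _).
  have root x r : x \in codom b -> x \in verts b r by rewrite mem_cat => ->.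
  rewrite !ver => hu hv uv.
  (* A branch without exchanges has only the vertices of [b], which the other branch contains
     too. *)
  have [z|z] : size (news s1) = 0 \/ size (news s2) = 0 by lia.
    have [|||//|d [ds ud vd]] := IH2 c2; first lia.
    + by case/orP: hu => // /(nil_bag _ _ z)/root.
    + by case/orP: hv => // /(nil_bag _ _ z)/root.
    by exists d; rewrite mem_cat ds orbT.
  have [|||//|d [ds ud vd]] := IH1 c1; first lia.
  + by case/orP: hu => // /(nil_bag _ _ z)/root.
  + by case/orP: hv => // /(nil_bag _ _ z)/root.
  by exists d; rewrite mem_cat ds.
Qed.

Lemma pickle_rainbow b s : valid b s -> rainbow (bags b s) pickle.
Proof. by move=> vb d /(bag_inj vb) di a a' /= /(pcan_inj pickleK)/di. Qed.

(** [J] is chosen before the tree, so that the families of the three pieces share their indices and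
    can be glued index by index. Each halving costs [N - 1] shift colourings, and [k] halvings lead
    to at most two exchanges. *)
Lemma split_colorings N k : odd N -> t < N ->
  exists J : finType, #|J| = N.-1 * k + 1 /\
  forall b s chi, valid b s -> slotted (bags b s) chi -> size (news s) <= 2 ^ k.+1 ->
  exists c : J -> V -> nat, (forall j, rainbow (bags b s) (c j)) /\
    forall u v, u \in verts b s -> v \in verts b s -> chi u != chi v ->
      (forall d : bag, d \in bags b s -> u \in codom d -> v \notin codom d) ->
      exists j, c j u = c j v.
Proof.
move=> oN tN.
have small (J : finType) b s chi : valid b s -> slotted (bags b s) chi ->
    size (news s) <= 1 -> exists c : J -> V -> nat,
    (forall j, rainbow (bags b s) (c j)) /\
    forall u v, u \in verts b s -> v \in verts b s -> chi u != chi v ->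
      (forall d : bag, d \in bags b s -> u \in codom d -> v \notin codom d) ->
      exists j, c j u = c j v.
  move=> vb Hc sz; exists (fun _ => pickle); split; first by move=> _; apply: pickle_rainbow.
  move=> u v hu hv uv no; have [d [ds ud vd]] := common_bag_small Hc sz hu hv uv.
  by have := no d ds ud; rewrite vd.
elim: k => [|k [J [cJ IH]]].
  exists unit; split=> [|b s chi vb Hc sz]; first by rewrite card_unit muln0.
  case: (leqP (size (news s)) 1) => s1; first exact: small Hc s1.
  have s2 : size (news s) = 2 by move: sz; lia.
  have [|g [p [Hs szp]]] := @exists_split _ _ b s 1 vb; first by rewrite s2.
  rewrite s2 in szp.
  exists (fun _ v => if v \in codom g then (pickle v).+1 else 0); split.
    by move=> _; apply: single_rainbow Hs _ => // l; apply: szp.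
  move=> u v hu hv uv no; exists tt.
  have [vp gp sub cov _] := Hs.
  have [ku hku] := split_cover Hs hu; have [kv hkv] := split_cover Hs hv.
  (* Each piece has at most one exchange, so any two of its vertices in different slots share a bag.
     Hence [u] and [v] share no piece, both lie outside [g], and both get the colour 0. *)
  have same l : u \in pverts (p l) -> v \in pverts (p l) -> False.
    move=> ul vl; have Hl : slotted (pbags (p l)) chi by move=> d /sub; apply: Hc.
    have [d [ds ud vd]] := common_bag_small Hl (szp l) ul vl uv.
    by have := no d (sub _ _ ds) ud; rewrite vd.
  case: ifPn => ug; first by case: (same kv) => //; apply: bags_verts (gp kv) ug.
  by case: ifPn => vg //; case: (same ku) => //; apply: bags_verts (gp ku) vg.
exists ('I_N.-1 + J)%type; split=> [|b s chi vb Hc sz].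
  by rewrite card_sum card_ord cJ; lia.
case: (leqP (size (news s)) 1) => s1; first exact: small Hc s1.
have [|g [p [Hs szp]]] := @exists_split _ _ b s (size (news s))./2 vb; first lia.
have [vp gp sub cov _] := Hs.
have /fin_all_exists[ck hck] : forall l : 'I_3, exists c : J -> V -> nat,
    (forall j, rainbow (pbags (p l)) (c j)) /\
    forall u v, u \in pverts (p l) -> v \in pverts (p l) -> chi u != chi v ->
      (forall d : bag, d \in pbags (p l) -> u \in codom d -> v \notin codom d) ->
      exists j, c j u = c j v.
  move=> l; apply: IH; [exact: vp | by move=> d /sub; apply: Hc |].
  apply: leq_trans (szp l) _; move: sz; rewrite [2 ^ k.+2]expnS; lia.
have /fin_all_exists[cg hcg] : forall j, exists c, rainbow (bags b s) c /\
    forall l u v, u \in pverts (p l) -> v \in pverts (p l) ->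
      ck l j u = ck l j v -> c u = c v.
  by move=> j; apply: (glue Hs) => l; have [] := hck l.
pose sh i v := if v \in codom g then pickle (inl v : V + nat)
               else pickle (inr ((chi v + part p v * i) %% N) : V + nat).
exists (fun j : 'I_N.-1 + J => match j with inl i => sh i.+1 | inr j => cg j end); split.
  by move=> [i|j]; [exact: (shift_rainbow Hs Hc tN) | have [] := hcg j].
move=> u v hu hv uv no.
have [ku hku] := split_cover Hs hu; have [kv hkv] := split_cover Hs hv.
have same l : u \in pverts (p l) -> v \in pverts (p l) ->
    exists j, cg j u = cg j v.
  move=> ul vl; have [_ h] := hck l; have [|j e] := h u v ul vl uv.
    by move=> d /sub; apply: no.
  by exists j; have [_ h'] := hcg j; apply: h' ul vl e.
have lift : (exists j, cg j u = cg j v) -> exists j : 'I_N.-1 + J,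
    match j with inl i => sh i.+1 | inr j => cg j end u =
    match j with inl i => sh i.+1 | inr j => cg j end v.
  by case=> j e; exists (inr j).
(* A vertex of [g] lies in all pieces, so the pair then lies in one piece and the recursion settles
   it. *)
case: (boolP (u \in codom g)) => ug.
  by apply/lift/(same kv) => //; apply: bags_verts (gp kv) ug.
case: (boolP (v \in codom g)) => vg.
  by apply/lift/(same ku) => //; apply: bags_verts (gp ku) vg.
case: (eqVneq ku kv) => [kk|kk]; first by apply/lift/(same ku); rewrite // kk.
have lN (a : 'I_t.+1) : a < N by apply: leq_trans (ltn_ord a) tN.
(* The multiplier is between 1 and [N - 1]; its predecessor is the index of the colouring. *)
have [[//|i] /= iN e] :=
  cross_shift oN (lN (chi u)) (lN (chi v)) uv (ltn_ord ku) (ltn_ord kv) kk.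
have iN' : i < N.-1 by lia.
exists (inl (Ordinal iN')); rewrite /sh (negbTE ug) (negbTE vg).
by rewrite (partE Hs hku ug) (partE Hs hkv vg) /= e.
Qed.

End Colorings.

(** * Colourings for pairs with a common slot or bag, and the encoding *)

Lemma has_encoding_of_family (V : finType) (E : rel V) (J : finType)
    (c : J -> V -> nat) :
  (forall u v, (forall j, c j u = c j v) -> u = v) ->
  (forall u v, E u v <-> forall j, c j u <> c j v) ->
  has_encoding E #|J|.
Proof.
move=> ci cE; exists (fun v => [ffun k => c (enum_val k) v]); split=> [u v e|u v].
  apply: ci => j; have := congr1 (fun f : {ffun _} => f (enum_rank j)) e.
  by rewrite !ffunE enum_rankK.
rewrite cE; split=> [h k|h j]; first by rewrite !ffunE; apply: h.
by have := h (enum_rank j); rewrite !ffunE enum_rankK.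
Qed.

(* For slots [a, b, i < N]: [a + b = i] modulo [N]. *)
Definition mate (N i a b : nat) := (a + b == i) || (a + b == i + N).

(** The smaller element of the orbit of [a] under the reflection [a -> i - a] modulo [N], a
    canonical name of the orbit. *)
Definition tag (N i a : nat) := minn a (if a <= i then i - a else i + N - a).

Lemma tag_mate N i a b : mate N i a b -> i < N -> a < N -> b < N ->
  tag N i a = tag N i b.
Proof. by rewrite /mate /tag => h; case: ifP; case: ifP; lia. Qed.

Lemma tag_inj N i a b : i < N -> a < N -> b < N -> tag N i a = tag N i b ->
  a = b \/ mate N i a b.
Proof. by rewrite /mate /tag; case: ifP; case: ifP; lia. Qed.

Lemma mate_sym N i a b : mate N i a b = mate N i b a.
Proof. by rewrite /mate addnC. Qed.

Lemma mate_uniq N i a b c : b < N -> c < N -> mate N i a b -> mate N i a c -> b = c.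
Proof. by rewrite /mate; lia. Qed.

Lemma exists_mate N a b : a < N -> b < N -> exists2 i, i < N & mate N i a b.
Proof.
move=> aN bN; exists (if a + b < N then a + b else a + b - N); case: ifP;
  by rewrite /mate; lia.
Qed.

Section Global.
Variables (V : finType) (E : rel V) (t N : nat).
Hypotheses (Esym : symmetric E) (Eirr : irreflexive E) (tN : t < N).
Notation bag := {ffun 'I_t.+1 -> V}.

Let slotN (a : 'I_t.+1) : a < N.
Proof. exact: leq_trans (ltn_ord a) tN. Qed.

(* The two classes of a pair of mates induce a forest inside the bags, so the
   signs can be chosen greedily along the tree. *)
Lemma signing i b s chi : valid b s -> slotted (bags b s) chi ->
  exists r : V -> bool, forall d : bag, d \in bags b s ->
    forall a c : 'I_t.+1, a != c -> mate N i a c -> r (d a) (+) r (d c) = E (d a) (d c).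
Proof.
move=> vb Hc.
have uniq_mate (a e f : 'I_t.+1) : mate N i a e -> mate N i a f -> e = f.
  by move=> h1 h2; apply/val_inj/(mate_uniq _ _ h1 h2).
pose Q (d : bag) (r : V -> bool) := forall a c : 'I_t.+1, a != c -> mate N i a c ->
  r (d a) (+) r (d c) = E (d a) (d c).
pose r0 v := if [pick e : 'I_t.+1 | (e != chi v) && mate N i (chi v) e] is Some e
  (* In a mated pair of the root bag the smaller slot gets [false] and the larger one the adjacency
     bit. *)
  then (e < chi v) && E v (b e) else false.
have [|||r [_ h]] := @extend_bags V t bool Q _ _ s b r0 vb; last by exists r.
- by move=> g c c' e h a d ad m; rewrite -!e; apply: h.
- move=> g c a y yg h.
  (* Slot [a] has at most one mate besides itself, so at most one equation constrains the sign of
     [y]; this solves it. *)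
  pose x := if [pick e : 'I_t.+1 | (e != a) && mate N i a e] is Some e
    then c (g e) (+) E y (g e) else false.
  have xE (e : 'I_t.+1) : e != a -> mate N i a e -> x (+) c (g e) = E y (g e).
    move=> ea m; rewrite /x; case: pickP => [f /andP[fa m']|/(_ e)]; last by rewrite ea m.
    by rewrite (uniq_mate _ _ _ m' m) addbAC addbb.
  have gy e : (g e == y) = false by apply: contraNF yg => /eqP<-; apply: codom_f.
  exists x => e f ef m; rewrite !ffunE.
  case: (eqVneq e a) => [ea|ea]; case: (eqVneq f a) => [fa|fa].
  + by rewrite ea fa eqxx in ef.
  + by rewrite eqxx gy; apply: xE; rewrite // -ea.
  + by rewrite eqxx gy addbC Esym; apply: xE; rewrite // -fa mate_sym.
  + by rewrite !gy; apply: h.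
- have bc c : chi (b c) = c by apply: Hc; apply: mem_root.
  move=> a c; wlog ac : a c / a < c => [H ac|_ m].
    move: (ac); rewrite neq_ltn => /orP[/H|ca m]; first exact.
    by rewrite addbC Esym; apply: H => //; rewrite 1?eq_sym // mate_sym.
  have r0E (e f : 'I_t.+1) : e != f -> mate N i e f -> r0 (b e) = (f < e) && E (b e) (b f).
    move=> ef m'; rewrite /r0 bc; case: pickP => [f' /andP[_ m2]|/(_ f)].
      by rewrite (uniq_mate _ _ _ m2 m').
    by rewrite eq_sym ef m'.
  have nac : a != c by rewrite neq_ltn ac.
  rewrite (r0E a c) // (r0E c a) 1?eq_sym 1?mate_sym //.
  by rewrite ac ltnNge (ltnW ac) /= Esym.
Qed.

(* Colouring [i] merges each slot class with its mate as far as [E] permits inside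
   the bags, and collapses the class that is its own mate. *)
Lemma mate_colorings b s chi : valid b s -> slotted (bags b s) chi ->
  (forall u v, E u v -> exists d : bag, [/\ d \in bags b s, u \in codom d & v \in codom d]) ->
  exists c : 'I_N -> V -> nat,
  [/\ forall i u v, E u v -> c i u <> c i v,
      forall u v, chi u = chi v -> exists i, c i u = c i v &
      forall d : bag, d \in bags b s -> forall u v, u \in codom d -> v \in codom d ->
        ~~ E u v -> exists i, c i u = c i v].
Proof.
move=> vb Hc Ebag.
have /fin_all_exists[r hr] : forall i : 'I_N, exists r : V -> bool,
    forall d : bag, d \in bags b s -> forall a c : 'I_t.+1, a != c -> mate N i a c ->
    r (d a) (+) r (d c) = E (d a) (d c).
  by move=> i; apply: signing vb Hc.
pose c (i : 'I_N) v := pickle (tag N i (chi v), ~~ mate N i (chi v) (chi v) && r i v).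
have self u v : chi u = chi v -> exists i, c i u = c i v.
  (* For this index the slot of [u] is its own mate, so its whole class gets one colour. *)
  move=> uv; have [i iN m] := exists_mate (slotN (chi u)) (slotN (chi u)).
  by exists (Ordinal iN); rewrite /c /= -uv m.
have nself (i : 'I_N) (a e : 'I_t.+1) : a != e -> mate N i a e -> mate N i a a = false.
  move=> ae m; apply: contraNF ae => m'; apply/eqP/val_inj.
  exact: mate_uniq m' m.
exists c; split=> //.
- move=> i u v uv /(pcan_inj pickleK)[/(tag_inj (ltn_ord i) (slotN _) (slotN _)) h].
  have [d [ds /codomP[a ua] /codomP[e ve]]] := Ebag _ _ uv.
  have ae : a != e by apply/eqP => ae; rewrite ua ve ae Eirr in uv.
  move: h; rewrite ua ve !(Hc d ds) => -[/val_inj/eqP|m]; first by rewrite (negbTE ae).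
  have ea : e != a by rewrite eq_sym.
  have m' : mate N i e a by rewrite mate_sym.
  rewrite (nself _ _ _ ae m) (nself _ _ _ ea m') /= => rr.
  by have := hr i d ds a e ae m; rewrite rr addbb -ua -ve uv.
- move=> d ds u v /codomP[a ->] /codomP[e ->] nE.
  case: (eqVneq a e) => [->|ae]; first exact: self.
  have [i iN m] := exists_mate (slotN a) (slotN e); exists (Ordinal iN).
  have ea : e != a by rewrite eq_sym.
  have m' : mate N i e a by rewrite mate_sym.
  rewrite /c /= !(Hc d ds) (tag_mate m) //.
  rewrite (nself (Ordinal iN) _ _ ae m) (nself (Ordinal iN) _ _ ea m') /=.
  have := hr (Ordinal iN) d ds a e ae m; rewrite (negbTE nE) => /eqP.
  by rewrite addbC; case: (r _ _); case: (r _ _).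
Qed.

(** The summands count the mate colourings, the split colourings and one injective colouring. *)
Lemma encoding_of_stree b s k : odd N -> valid b s -> (forall v, v \in verts b s) ->
  (forall u v, E u v -> exists d : bag, [/\ d \in bags b s, u \in codom d & v \in codom d]) ->
  size (news s) <= 2 ^ k.+1 -> has_encoding E (N + (N.-1 * k + 1) + 1).
Proof.
move=> oN vb cov Ebag sz; have [chi Hc] := slot_function vb.
have [c1 [c1E c1s c1b]] := mate_colorings vb Hc Ebag.
have [J [cJ hJ]] := @split_colorings V t N k oN tN.
have [c2 [c2r c2s]] := hJ b s chi vb Hc sz.
have -> : N + (N.-1 * k + 1) + 1 = #|{: ('I_N + J) + unit}|.
  by rewrite !card_sum card_ord card_unit cJ.
apply: (@has_encoding_of_family _ _ _ (fun j => match j with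
  | inl (inl i) => c1 i | inl (inr j) => c2 j | inr _ => @pickle V end)).
  by move=> u v /(_ (inr tt))/(pcan_inj pickleK).
move=> u v; split=> [uv [[i|j]|_]|h].
- exact: c1E.
- have [d [ds /codomP[a ua] /codomP[e ve]]] := Ebag _ _ uv.
  rewrite ua ve => /(c2r j d ds) ae.
  by rewrite ua ve ae Eirr in uv.
- by move/(pcan_inj pickleK) => e; rewrite e Eirr in uv.
- apply: contraT => nE.
  have no1 : ~ exists i, c1 i u = c1 i v by case=> i; apply: (h (inl (inl i))).
  have no2 : ~ exists i, c2 i u = c2 i v by case=> i; apply: (h (inl (inr i))).
  case: no2; apply: c2s => //; first by apply/eqP => /c1s.
  by move=> d ds ud; apply/negP => vd; apply: no1; apply: c1b ds _ _ ud vd nE.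
Qed.
End Global.

(** * The logarithmic bound *)

Lemma INR_expn k : INR (2 ^ k) = pow 2 k.
Proof. by elim: k => // k IH; rewrite expnS mult_INR IH. Qed.

Lemma log_bound l t n k : l <= t.+2 * k.+1 -> 2 ^ k <= n ->
  Rle (INR l) (Rmult (INR t.+2) (Rplus (Rdiv (ln (INR n)) (ln 2)) 1)).
Proof.
move=> /leP/le_INR lk /leP/le_INR kn; rewrite INR_expn in kn.
have ln2 : Rlt 0 (ln 2) by rewrite -ln_1; apply: ln_increasing; lra.
apply: Rle_trans lk _; rewrite mult_INR.
apply: Rmult_le_compat_l; first exact: pos_INR.
rewrite S_INR; apply: Rplus_le_compat_r; apply: (Rmult_le_reg_r (ln 2)) => //.
rewrite /Rdiv Rmult_assoc Rinv_l ?Rmult_1_r; last by lra.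
rewrite -ln_pow; last by lra.
case: kn => [kn|->]; last exact: Rle_refl.
by left; apply: ln_increasing kn; apply: pow_lt; lra.
Qed.

(* pdim(G) <= B  is stated as: some l-encoding exists with l <= B
   (pdim is the minimum such l). *)
Theorem theorem2 (V : finType) (E : rel V) (t : nat) :
  simple_graph E -> 0 < #|V| -> is_treewidth E t ->
  exists l : nat, has_encoding E l /\
    Rle (INR l) (Rmult (INR t.+2) (Rplus (Rdiv (ln (INR #|V|)) (ln 2)) 1)).
Proof.
case=> Esym Eirr V0 [[I [T [X [[[I0 Tsym _ Tconn _] Xcov XE Xint] wX]]]] _].
set n := #|V| in V0 *.
have [v0 _] := card_gt0P V0.
(* The subtraction in [width] truncates, so for [t = 0] an empty largest bag must be excluded; the
   bag of [v0] does this. *)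
have [r Xr] : exists r, #|X r| = t.+1.
  have [r rE] := eq_bigmax (fun i => #|X i|) I0; exists r.
  have [i iv] := Xcov v0.
  have Xi : 0 < #|X i| by apply/card_gt0P; exists v0.
  have := leq_bigmax (F := fun i => #|X i|) i.
  by move: wX; rewrite /width rE; lia.
have Xt i : #|X i| <= t.+1.
  by have := leq_bigmax (F := fun i => #|X i|) i; move: wX; rewrite /width; lia.
(* For a single vertex one constant coordinate suffices; the general count would be too large. *)
case: (leqP n 1) => n1.
  have all1 (u v : V) : u = v by apply: (fintype_le1P n1).
  exists 1; split; last by apply: (@log_bound _ _ _ 0).
  rewrite -card_unit; apply: (@has_encoding_of_family _ _ _ (fun _ _ => 0)) => u v.
    by move=> _; apply: all1.
  by rewrite (all1 u v) Eirr; split=> // /(_ tt).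
have [b [s [vb vE hb]]] := stree_of_decomposition Tsym Tconn Xint Xt Xr.
have cov v : v \in verts b s by rewrite vE inE; apply/existsP.
have Ebag u v : E u v ->
    exists d : {ffun 'I_t.+1 -> V}, [/\ d \in bags b s, u \in codom d & v \in codom d].
  case/XE=> i /andP[ui vi]; have [d ds sub] := hb i.
  by exists d; split=> //; apply: sub.
have sz : t.+1 + size (news s) = n.
  rewrite -(size_verts b) /n; apply/esym; have /card_uniqP <- := vb.
  by apply: eq_card => v; rewrite cov.
pose N := t.+1 + odd t.
have oN : odd N by rewrite /N oddD /= oddb; case: (odd t).
have tN : t < N by rewrite /N; lia.
have N2 : N <= t.+2 by rewrite /N; case: (odd t); lia.
(* With two or three vertices there are at most two exchanges, so [k = 0] suffices, although the
   rounded logarithm is 1; the count for [k = 1] can exceed the bound. *)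
case: (leqP n 3) => n3.
  have hs : size (news s) <= 2 ^ 1 by rewrite /=; lia.
  exists (N + (N.-1 * 0 + 1) + 1); split.
    exact: (encoding_of_stree (k := 0) Esym Eirr tN oN vb cov Ebag hs).
  by apply: (@log_bound _ _ _ 1) => //; lia.
have /andP[kn nk] := trunc_log_bounds (isT : 1 < 2) V0.
(* The count is at most [(t+2)(k+1) + 2 - k], so [k >= 2] absorbs the excess. *)
have k2 : 1 < trunc_log 2 n by apply: trunc_log_max; lia.
move: k2 kn nk; set k := trunc_log 2 n => k2 kn nk.
have hs : size (news s) <= 2 ^ k.+1 by lia.
exists (N + (N.-1 * k + 1) + 1); split.
  exact: (encoding_of_stree Esym Eirr tN oN vb cov Ebag hs).
apply: log_bound kn.
have : N.-1 * k <= t.+1 * k by rewrite leq_mul2r; lia.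
by rewrite mulnS mulSn; lia.
Qed.
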